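(* Let $p>3$ be a prime and let $b$ be any integer. For integers $a$ and $b$ define $$N_p(a,b):=\left|\left\{x\in\mathbb Z:\ 1\le x\le \tfrac{p-1}2,\ \{x^2+b\}_p>\{ax^2+b\}_p\right\}\right|,$$ where $\{m\}_p$ denotes the least nonnegative residue of the integer $m$ modulo $p$. Set $$S=\left\{N_p(a,b):\ a\in\mathbb Z,\ 1<a<p,\ \left(\frac ap\right)=1\right\}$$ and $$T=\left\{N_p(a,b):\ a\in\mathbb Z,\ 1<a<p,\ \left(\frac ap\right)=-1\right\}.$$ Then $|S|=|T|=1$ if $p\equiv1\pmod4$, and $|S|=|T|=2$ if $p\equiv3\pmod4$. Moreover, the set $S$ does not depend on the value of $b$.
   Context: $\left(\frac{\cdot}{p}\right)$ denotes the Legendre symbol modulo the odd prime $p$. For an integer $m$, $\{m\}_p\in\{0,1,\ldots,p-1\}$ is the least nonnegative residue of $m$ modulo $p$. *)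

(* Defs.v *)
From mathcomp Require Import all_boot all_order all_algebra.
From mathcomp Require Import finmap.

Set Implicit Arguments.
Unset Strict Implicit.
Unset Printing Implicit Defensive.

Import Order.TTheory GRing.Theory Num.Theory.

Local Open Scope ring_scope.

(* It suffices to look for a square root among the residues 0, ..., p - 1. *)
Definition legendre (p : nat) (a : int) : int :=
  if (p%:Z %| a)%Z then 0
  else if [exists x : 'I_p, (x%:Z ^+ 2 == a %[mod p%:Z])%Z] then 1
  else -1.

(* For p > 0, [(m %% p)%Z] is the least nonnegative residue of the integer m.
   All integers x with 1 <= x <= (p - 1) / 2 are among the elements of 'I_p. *)
Definition Np (p : nat) (a b : int) : nat :=
  #|[set x : 'I_p | (1 <= x <= p.-1./2)%N &&
      (((a * x%:Z ^+ 2 + b) %% p%:Z)%Z < ((x%:Z ^+ 2 + b) %% p%:Z)%Z)]|.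

(* The set of values of N_p(a, b), for the integers a with 1 < a < p and
   Legendre symbol e. *)
Definition Np_values (e : int) (p : nat) (b : int) : {fset nat} :=
  [fset Np p (nat_of_ord a)%:Z b
     | a in [pred a : 'I_p | (1 < a)%N & legendre p a%:Z == e]]%fset.

Definition Sset (p : nat) (b : int) : {fset nat} := Np_values 1 p b.

Definition Tset (p : nat) (b : int) : {fset nat} := Np_values (-1) p b.

(* Main.v *)
(* Write {m} for the residue of m. As [{u} < {w}] = ({u - w} + {w} - {u}) / p,
   summing over the nonzero squares s gives
     p N_p(a, b) = A(a - 1, 0) + A(1, b) - A(a, b),
   where A(a, b) is the sum of the {as + b}. For a <> 0, A(a, b) depends on a
   only through its quadratic character, so for a in a fixed class N_p(a, b)
   depends only on the class of a - 1, and not on b when a is a square.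
   Pairing s with -s gives A(c, 0) + A(-c, 0) = p (p - 1) / 2. If p = 1 mod 4,
   then c and -c lie in the same class and A(c, 0) is constant; if p = 3 mod 4,
   they lie in different classes and the total is odd, so the two classes give
   different sums. It remains to see which classes of (a - 1, a) occur. *)

Require Import Defs.
From mathcomp Require Import all_boot all_order all_algebra.
From mathcomp Require Import finmap.
From mathcomp Require Import all_field zify ring.

Set Implicit Arguments.
Unset Strict Implicit.
Unset Printing Implicit Defensive.

Import GRing.Theory.

Local Open Scope ring_scope.

Section PrimeField.

Variables (p : nat) (p_prime : prime p) (p_gt3 : (3 < p)%N).

Local Notation h := p.-1./2.

(** The sum [A(a, b)]. By [half_sqr_image], [s ^+ h == 1] selects exactly the nonzero squares. *)
Definition residue_sum (a b : 'F_p) : nat :=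
  (\sum_(s : 'F_p | s ^+ h == 1%R) (a * s + b)%R)%N.

(** [N_p(a, b)] indexed by the square [s = x^2] instead of by [x]. *)
Definition descent_count (a b : 'F_p) : nat :=
  #|[set s : 'F_p | (s ^+ h == 1) && ((a * s + b)%R < (s + b)%R)%N]|.

(** * Least residues and arithmetic in ['F_p] *)

Lemma Fp_intr_eq0 (m : int) : ((m%:~R : 'F_p) == 0) = (p %| m)%Z.
Proof. by rewrite (dvdz_pcharf (pchar_Fp p_prime)). Qed.

Lemma Fp_natr_eq0 (n : nat) : ((n%:R : 'F_p) == 0) = (p %| n)%N.
Proof. by rewrite (dvdn_pcharf (pchar_Fp p_prime)). Qed.

Lemma Fp_natr_val (x : 'F_p) : (nat_of_ord x)%:R = x.
Proof. exact: natr_Zp. Qed.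

Lemma ltn_Fp (x : 'F_p) : (x < p)%N.
Proof. by rewrite -{2}(Fp_cast p_prime). Qed.

Lemma Fp_intr_val (m : int) : (m %% p)%Z = (nat_of_ord (m%:~R : 'F_p))%:Z.
Proof.
have p_gt0 := prime_gt0 p_prime.
have: (0 <= m %% p)%Z by apply: modz_ge0; lia.
have: ((m %% p)%Z < p)%R by apply: ltz_pmod; lia.
have -> : (m%:~R : 'F_p) = ((m %% p)%Z)%:~R.
  rewrite {1}(divz_eq m p) intrD intrM.
  by rewrite [X in _ * X](pchar_Fp_0 p_prime) mulr0 add0r.
case: (m %% p)%Z => n // n_lt _.
by rewrite -pmulrn val_Fp_nat // modn_small //; lia.
Qed.

(** Subtraction modulo [p] borrows one [p] exactly when [u < w]; moving terms across avoids
    truncated subtraction in [nat]. *)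
Lemma Fp_sub_val (u w : 'F_p) :
  (u + p * (u < w) = (u - w)%R + w)%N.
Proof.
have := ltn_Fp u; have := ltn_Fp w; have := ltn_Fp (u - w).
have: nat_of_ord u = (((u - w)%R + w) %% p)%N.
  by rewrite -val_Fp_nat // natrD !Fp_natr_val subrK.
set d := nat_of_ord (u - w); set u' := nat_of_ord u; set w' := nat_of_ord w.
have [le_p|lt_p] := leqP p (d + w').
  rewrite -(subnK le_p) modnDr => -> *; rewrite modn_small; lia.
by rewrite modn_small //; lia.
Qed.

(** * Nonzero squares and Euler's criterion *)

Lemma half_double : p = (h.*2).+1.
Proof.
have := odd_prime_gt2; have [//|] := even_prime p_prime; lia.
Qed.

Lemma euler_sqr (x : 'F_p) : x != 0 -> (x ^+ 2) ^+ h = 1.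
Proof.
(* Multiplying by [x] reduces the claim to Fermat's [x ^+ p = x]. *)
move=> x0; apply: (mulfI x0); rewrite mulr1 -exprM -exprS mul2n -half_double.
by have := expf_card x; rewrite card_Fp.
Qed.

Lemma euler_pm1 (x : 'F_p) : x != 0 -> x ^+ h = 1 \/ x ^+ h = -1.
Proof.
move=> /euler_sqr; rewrite exprAC => /eqP; rewrite sqrf_eq1.
by case/orP => /eqP; [left|right].
Qed.

Lemma Fp_opp1_neq1 : (-1 : 'F_p) != 1.
Proof.
by rewrite eq_sym -subr_eq0 opprK -(natrD _ 1 1) Fp_natr_eq0 gtnNdvd //; lia.
Qed.

Lemma half_gt0 : (0 < h)%N.
Proof. lia. Qed.

Lemma euler_neq0 (x e : 'F_p) : e != 0 -> x ^+ h = e -> x != 0.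
Proof.
move=> e0 xe; apply: contra_neq e0 => x0; rewrite -xe x0 expr0n.
by have := half_gt0; case: h.
Qed.

(** Equal squares give [x = y] or [x + y = 0] modulo [p]; the latter fails because
    [0 < x + y < p]. *)
Lemma half_sqr_inj :
  {in [set x : 'I_p | 1 <= x <= h] &,
     injective (fun x : 'I_p => (x%:R : 'F_p) ^+ 2)}%N.
Proof.
move=> x y; rewrite !inE => xh yh /eqP; rewrite eqf_sqr => /orP[] /eqP xy.
  apply/val_inj; move/(congr1 val): xy; rewrite /= !val_Fp_nat //.
  by rewrite !modn_small.
move/eqP: xy; rewrite -subr_eq0 opprK -natrD Fp_natr_eq0 gtnNdvd //.
  by lia.
by have := half_double; lia.
Qed.

Lemma card_nonzero_sqr_le : (#|[set s : 'F_p | (s ^+ h == 1)%R]| <= h)%N.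
Proof.
rewrite cardE; apply: max_unity_roots half_gt0 _ (enum_uniq _).
by apply/allP => x; rewrite mem_enum inE unity_rootE.
Qed.

Lemma leq_card_half : (h <= #|[set x : 'I_p | 1 <= x <= h]|)%N.
Proof.
have f_lt (i : 'I_h) : (i.+1 < p)%N by have := ltn_ord i; lia.
have f_inj : injective (fun i => Ordinal (f_lt i)).
  by move=> i j [] /val_inj.
rewrite -[X in (X <= _)%N]card_ord -(card_imset _ f_inj).
apply/subset_leq_card/subsetP => x /imsetP[i _ ->]; rewrite inE /=.
exact: ltn_ord.
Qed.

(** The left side consists of [h] distinct roots of [X^h - 1], which has at most [h] roots. *)
Lemma half_sqr_image :
  [set (x%:R : 'F_p) ^+ 2 | x : 'I_p in [set x : 'I_p | 1 <= x <= h]%N]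
  = [set s : 'F_p | s ^+ h == 1].
Proof.
apply/eqP; rewrite eqEcard; apply/andP; split.
  apply/subsetP => s /imsetP[x]; rewrite !inE => xh ->.
  rewrite euler_sqr // Fp_natr_eq0 gtnNdvd //; lia.
rewrite card_in_imset; last exact: half_sqr_inj.
exact: leq_trans card_nonzero_sqr_le leq_card_half.
Qed.

Lemma card_nonzero_sqr : #|[set s : 'F_p | s ^+ h == 1]| = h.
Proof.
apply/eqP; rewrite eqn_leq card_nonzero_sqr_le -half_sqr_image.
by rewrite card_in_imset; [exact: leq_card_half | exact: half_sqr_inj].
Qed.

Lemma legendreE (a : int) :
  legendre p a = if (a%:~R : 'F_p) == 0 then 0
                 else if (a%:~R : 'F_p) ^+ h == 1 then 1 else -1.
Proof.
rewrite /legendre Fp_intr_eq0; case: ifPn => // a_p.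
congr (if _ then _ else _); apply/existsP/idP => [[x]|].
  rewrite eqz_mod_dvd -Fp_intr_eq0 rmorphB rmorphXn /= subr_eq0 => /eqP ax.
  move: a_p; rewrite -Fp_intr_eq0 -ax sqrf_eq0 => x0.
  exact/eqP/euler_sqr.
move=> ah; have: (a%:~R : 'F_p) \in [set s : 'F_p | s ^+ h == 1] by rewrite inE.
rewrite -half_sqr_image => /imsetP[x _ ax]; exists x.
by rewrite eqz_mod_dvd -Fp_intr_eq0 rmorphB rmorphXn /= ax subr_eq0.
Qed.

Lemma Np_Fp (a b : int) : Np p a b = descent_count a%:~R b%:~R.
Proof.
rewrite /Np /descent_count.
rewrite -(card_in_imset (f := fun x : 'I_p => (x%:R : 'F_p) ^+ 2)); last first.
  move=> x y; rewrite !inE => /andP[xh _] /andP[yh _].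
  by apply: half_sqr_inj; rewrite inE.
have E (x : 'I_p) : (((a * x%:Z ^+ 2 + b) %% p)%Z < ((x%:Z ^+ 2 + b) %% p)%Z)%R
    = (((a%:~R : 'F_p) * x%:R ^+ 2 + b%:~R)%R < (x%:R ^+ 2 + b%:~R : 'F_p)%R)%N.
  by rewrite !Fp_intr_val !rmorphD rmorphM !rmorphXn.
congr #|pred_of_set _|; apply/setP => s; rewrite inE.
apply/imsetP/andP => [[x]|[]].
  rewrite inE E => /andP[xh lt] ->; split => //.
  have: (x%:R : 'F_p) ^+ 2 \in [set s : 'F_p | s ^+ h == 1].
    by rewrite -half_sqr_image; apply/imsetP; exists x; rewrite ?inE.
  by rewrite inE.
move=> sh; have: s \in [set s : 'F_p | s ^+ h == 1] by rewrite inE.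
rewrite -half_sqr_image => /imsetP[x]; rewrite inE => xh -> lt.
by exists x; rewrite // inE xh E.
Qed.

(** * Residue sums and their dependence on quadratic classes *)

Lemma residue_sum_class (a b : 'F_p) : a != 0 ->
  residue_sum a b = (\sum_(x : 'F_p | x ^+ h == a ^+ h) (x + b)%R)%N.
Proof.
move=> a0; rewrite [RHS](reindex_onto (fun s => a * s) (fun x => x / a)) /=.
  apply: eq_bigl => s; rewrite exprMn -{2}[a ^+ h]mulr1.
  by rewrite (inj_eq (mulfI (expf_neq0 _ a0))) mulrAC divff // mul1r eqxx andbT.
by move=> x _; rewrite mulrCA divff // mulr1.
Qed.

Lemma residue_sum_congr (a a' b : 'F_p) :
  a != 0 -> a' != 0 -> a ^+ h = a' ^+ h -> residue_sum a b = residue_sum a' b.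
Proof. by move=> a0 a'0 aa'; rewrite !residue_sum_class // aa'. Qed.

(** [Fp_sub_val] for [u = a * s + b] and [w = s + b], summed over [s]; here [b] drops out of
    [u - w]. *)
Lemma descent_countE (a b : 'F_p) :
  (residue_sum a b + p * descent_count a b
   = residue_sum (a - 1)%R 0%R + residue_sum 1%R b)%N.
Proof.
rewrite /descent_count -sum1dep_card big_mkcondr big_distrr -!big_split.
apply: eq_bigr => s _; cbv beta.
have := Fp_sub_val (a * s + b) (s + b).
have -> : a * s + b - (s + b) = (a - 1) * s + 0 by ring.
by rewrite mul1r; case: ltnP.
Qed.

(** Each of the [h] squares contributes [p], the residues of [c * s] and its negative being
    complementary as [c * s] is nonzero. *)
Lemma residue_sumN (c : 'F_p) : c != 0 ->
  (residue_sum c 0%R + residue_sum (- c)%R 0%R = p * h)%N.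
Proof.
move=> c0; rewrite -big_split -[in RHS]card_nonzero_sqr mulnC -sum_nat_cond_const.
apply: eq_bigr => s /eqP sh; cbv beta; rewrite !addr0 mulNr.
have cs0 : c * s != 0 by rewrite mulf_neq0 // (euler_neq0 _ sh) ?oner_neq0.
have cs_gt0 : (0 < nat_of_ord (c * s)%R)%N by rewrite lt0n.
have := Fp_sub_val 0 (c * s); rewrite sub0r [nat_of_ord 0]/= cs_gt0.
by rewrite muln1 add0n addnC.
Qed.


(** Here [h] is even, so [c] and [- c] share a class and each sum is half of [p * h]. *)
Lemma residue_sum0_const (c c' : 'F_p) : (p %% 4 = 1)%N ->
  c != 0 -> c' != 0 -> residue_sum c 0 = residue_sum c' 0.
Proof.
move=> p1; have h_even : odd h = false by lia.
have dbl (d : 'F_p) : d != 0 -> (residue_sum d 0%R).*2 = (p * h)%N.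
  move=> d0; rewrite -(residue_sumN d0) -addnn; congr addn.
  by apply: residue_sum_congr; rewrite ?oppr_eq0 // exprNn -signr_odd h_even mul1r.
by move=> c0 c'0; apply: double_inj; rewrite !dbl.
Qed.

Lemma exprN_odd_half (c : 'F_p) : (p %% 4 = 3)%N -> (- c) ^+ h = - c ^+ h.
Proof.
move=> p3; have h_odd : odd h = true by lia.
by rewrite exprNn -signr_odd h_odd mulN1r.
Qed.

(* The sums at [c] and [- c] add up to [p * h], which is odd. *)
Lemma residue_sum0_eq (c c' : 'F_p) : (p %% 4 = 3)%N -> c != 0 -> c' != 0 ->
  (residue_sum c 0 == residue_sum c' 0) = (c ^+ h == c' ^+ h).
Proof.
move=> p3 c0 c'0; apply/eqP/eqP => [|cc']; last exact: residue_sum_congr.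
case: (eqVneq (c ^+ h) (c' ^+ h)) => // neq_cc' eq_sum.
have c'N : c' ^+ h = (- c) ^+ h.
  rewrite exprN_odd_half //; move: neq_cc'.
  case: (euler_pm1 c0) => ->; case: (euler_pm1 c'0) => ->;
    by rewrite ?eqxx ?opprK.
have := residue_sumN c0; rewrite -(residue_sum_congr 0 c'0 _ c'N) ?oppr_eq0 //.
rewrite -eq_sum addnn => /(congr1 odd).
rewrite odd_double oddM.
have -> : odd h by lia.
by have -> : odd p by lia.
Qed.

(** The sums at [a] and [a'] agree, so they cancel between the two instances of [descent_countE]. *)
Lemma descent_count_eq (a a' b : 'F_p) : a != 0 -> a' != 0 ->
  a ^+ h = a' ^+ h ->
  (descent_count a b == descent_count a' b)
  = (residue_sum (a - 1) 0 == residue_sum (a' - 1) 0).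
Proof.
move=> a0 a'0 aa'; have := descent_countE a b; have := descent_countE a' b.
rewrite (residue_sum_congr b a0 a'0 aa') => E E'.
rewrite -[RHS](eqn_add2r (residue_sum 1 b)) -E -E' eqn_add2l eqn_pmul2l //.
exact: prime_gt0.
Qed.

(** As [a] and [1] lie in one class, both sums involving [b] in [descent_countE] cancel. *)
Lemma descent_count_shift (a b b' : 'F_p) :
  a ^+ h = 1 -> descent_count a b = descent_count a b'.
Proof.
move=> a1; have a0 : a != 0 by rewrite (euler_neq0 _ a1) ?oner_neq0.
have E d : (p * descent_count a d = residue_sum (a - 1)%R 0%R)%N.
  apply: (@addnI (residue_sum a d)); rewrite descent_countE addnC.
  congr addn; apply: residue_sum_congr; rewrite ?oner_neq0 //.
  by rewrite expr1n a1.
by apply/eqP; rewrite -(eqn_pmul2l (prime_gt0 p_prime)) !E.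
Qed.

(** * Which classes of [a] and [a - 1] occur together *)

Lemma ex_sqr_nonsqr : exists2 a : 'F_p, a ^+ h = -1 & (a - 1) ^+ h = 1.
Proof.
have [x xN] : exists x : 'F_p, x ^+ h = -1.
  (* Otherwise all [p - 1] nonzero elements would be among the [h] squares. *)
  apply/'exists_eqP; apply: contraT => /existsPn all_sqr.
  have: ([set~ (0 : 'F_p)] \subset [set s : 'F_p | s ^+ h == 1]).
    apply/subsetP => s; rewrite !inE => /euler_pm1[/eqP //|sN].
    by have := all_sqr s; rewrite sN eqxx.
  move/subset_leq_card; rewrite card_nonzero_sqr cardsC1 card_Fp //.
  by have := half_double; lia.
have exP : exists n, (n < p)%N && ((n%:R : 'F_p) ^+ h == -1).
  by exists x; rewrite ltn_Fp Fp_natr_val xN eqxx.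
(* The witness is the least nonsquare [n]: its predecessor is nonzero, since [1] is a square, and is
   a square by minimality. *)
case: (ex_minnP exP) => n /andP[n_p /eqP nN] n_min.
have n_gt0 : (0 < n)%N.
  have: (n%:R : 'F_p) != 0 by rewrite (euler_neq0 _ nN) ?oppr_eq0 ?oner_neq0.
  by case: n {n_p nN n_min}; rewrite ?eqxx.
exists n%:R => //; rewrite -(natrB _ n_gt0) subn1.
have [|//|mN] := @euler_pm1 (n.-1%:R); last first.
  have := n_min n.-1; rewrite mN eqxx; lia.
rewrite Fp_natr_eq0 gtnNdvd //; last by lia.
rewrite -subn1 subn_gt0 ltn_neqAle n_gt0 andbT; apply/eqP => n1.
by move: nN Fp_opp1_neq1; rewrite -n1 expr1n => <-; rewrite eqxx.
Qed.

(* One of 2, 5, 10 = 2 * 5 is a square, and it follows one of 1, 4, 9. *)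
Lemma ex_sqr_sqr : (p %% 4 = 3)%N ->
  exists2 a : 'F_p, a ^+ h = 1 & (a - 1) ^+ h = 1.
Proof.
move=> p3.
have n0 k : (0 < k < p)%N -> (k%:R : 'F_p) != 0.
  by move=> k_p; rewrite Fp_natr_eq0 gtnNdvd //; lia.
have two0 := n0 2%N; have three0 := n0 3%N; have five0 := n0 5%N.
have [|two1|two1] := @euler_pm1 2; first by apply: two0; lia.
  by exists 2; rewrite // -(natrB _ (_ : 1 <= 2)%N) // expr1n.
have [|five1|five1] := @euler_pm1 5; first by apply: five0; lia.
  exists 5; rewrite // -(natrB _ (_ : 1 <= 5)%N) // (natrX _ 2 2).
  by rewrite euler_sqr // two0; lia.
exists 10; rewrite -?(natrB _ (_ : 1 <= 10)%N) //.
  by rewrite (natrM _ 2 5) exprMn two1 five1 mulrNN mulr1.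
by rewrite (natrX _ 3 2) euler_sqr // three0; lia.
Qed.

(** Inversion keeps [a] a square but flips the class of [a - 1], because [-1] is a nonsquare. *)
Lemma ex_sqr_split : (p %% 4 = 3)%N ->
  exists a a' : 'F_p,
    [/\ a ^+ h = 1, a' ^+ h = 1, (a - 1) ^+ h = 1 & (a' - 1) ^+ h = -1].
Proof.
move=> p3; have [a a1 a11] := ex_sqr_sqr p3; exists a, a^-1.
have a0 : a != 0 by rewrite (euler_neq0 _ a1) ?oner_neq0.
split; rewrite // ?exprVn ?a1 ?invr1 //.
have -> : a^-1 - 1 = - (a - 1) / a by field.
by rewrite exprMn exprVn exprN_odd_half // a11 a1 divr1.
Qed.

(** If [c] and [c - 1] are squares, their negatives [(1 - c) - 1] and [1 - c] are nonsquares. *)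
Lemma ex_nonsqr_split : (p %% 4 = 3)%N ->
  exists a a' : 'F_p,
    [/\ a ^+ h = -1, a' ^+ h = -1, (a - 1) ^+ h = 1 & (a' - 1) ^+ h = -1].
Proof.
move=> p3; have [a aN a1] := ex_sqr_nonsqr.
have [c c1 c11] := ex_sqr_sqr p3; exists a, (1 - c); split => //.
  by rewrite -opprB exprN_odd_half // c11.
by rewrite addrAC subrr add0r exprN_odd_half // c1.
Qed.

(** * The value sets and their cardinalities *)

Lemma Np_valuesP (e : bool) (b : int) (v : nat) :
  reflect (exists a : 'F_p,
             [/\ a != 1, a ^+ h = (-1) ^+ e & v = descent_count a b%:~R])
          (v \in Np_values ((-1) ^+ e) p b).
Proof.
have e_neq0 : (-1) ^+ e != 0 :> 'F_p by rewrite signr_eq0.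
have legE (a : int) : (legendre p a == (-1) ^+ e)
    = ((a%:~R : 'F_p) ^+ h == (-1) ^+ e).
  rewrite legendreE; case: (eqVneq (a%:~R : 'F_p) 0) => [->|a0].
    rewrite expr0n gtn_eqF ?half_gt0 //.
    by rewrite ![0 == _]eq_sym !signr_eq0.
  have [->|->] := euler_pm1 a0.
    by rewrite eqxx; case: e {e_neq0}; rewrite ?eqxx // [RHS]eq_sym (negPf Fp_opp1_neq1).
  by rewrite (negPf Fp_opp1_neq1); case: e {e_neq0}; rewrite ?eqxx // (negPf Fp_opp1_neq1).
apply: (iffP (imfsetP _ _ _ _)) => [[a]|[a [a1 ae ->]]].
  case/andP => a_gt1; rewrite legE => /eqP ae ->.
  exists (a%:R); split; rewrite ?Np_Fp // -subr_eq0 -(natrB _ (ltnW a_gt1)).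
  by rewrite Fp_natr_eq0 gtnNdvd //; have := ltn_ord a; lia.
exists (Ordinal (ltn_Fp a)); last by rewrite Np_Fp /= -pmulrn Fp_natr_val.
apply/andP; split; last by rewrite legE -pmulrn Fp_natr_val ae.
(* Zero has Euler power [0], not a sign, so [a != 1] suffices for [1 < a]. *)
have a0 : a != 0 by rewrite (euler_neq0 e_neq0 ae).
rewrite ltnNge; apply: contra a1 => a_le1.
have a_gt0 : (0 < nat_of_ord a)%N by rewrite lt0n.
by rewrite -(Fp_natr_val a) (_ : nat_of_ord a = 1%N) //; move: a_le1 => /=; lia.
Qed.

End PrimeField.

Lemma Np_values_card1 (p : nat) (e : bool) (b : int) :
  prime p -> (3 < p)%N -> (p %% 4 = 1)%N ->
  #|` Np_values ((-1) ^+ e) p b|%fset = 1%N.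
Proof.
move=> p_prime p_gt3 p1.
have e0 : (-1) ^+ e != 0 :> 'F_p by rewrite signr_eq0.
have [a a1 ae] : exists2 a : 'F_p, a != 1 & a ^+ p.-1./2 = (-1) ^+ e.
  case: e {e0} => /=.
    have [a aN _] := ex_sqr_nonsqr p_prime p_gt3; exists a => //.
    apply: contraNneq (Fp_opp1_neq1 p_prime p_gt3) => a1.
    by rewrite -aN a1 expr1n.
  (* The square [4] differs from [1] because [p] does not divide [3]. *)
  exists (2 ^+ 2).
    rewrite -subr_eq0 -natrX -(natrB _ (_ : 1 <= 2 ^ 2)%N) //.
    by rewrite Fp_natr_eq0 // gtnNdvd //; lia.
  by rewrite (euler_sqr p_prime) // (Fp_natr_eq0 p_prime 2) gtnNdvd //; lia.
apply/eqP/cardfs1P; exists (descent_count a b%:~R).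
apply/fsetP => v; rewrite !inE; apply/Np_valuesP/eqP => // [[c [c1 ce ->]]|->].
  apply/eqP; rewrite (descent_count_eq p_prime) ?ce ?ae //.
  - by apply/eqP/residue_sum0_const; rewrite ?subr_eq0.
  - exact: (euler_neq0 p_prime p_gt3 e0 ce).
  - exact: (euler_neq0 p_prime p_gt3 e0 ae).
by exists a.
Qed.

Lemma Np_values_card2 (p : nat) (e : bool) (b : int) :
  prime p -> (3 < p)%N -> (p %% 4 = 3)%N ->
  #|` Np_values ((-1) ^+ e) p b|%fset = 2%N.
Proof.
move=> p_prime p_gt3 p3.
have e0 : (-1) ^+ e != 0 :> 'F_p by rewrite signr_eq0.
have [a [a' [ae a'e a1 a'N]]] : exists a a' : 'F_p,
    [/\ a ^+ p.-1./2 = (-1) ^+ e, a' ^+ p.-1./2 = (-1) ^+ e,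
        (a - 1) ^+ p.-1./2 = 1 & (a' - 1) ^+ p.-1./2 = -1].
  by case: e {e0}; [exact: ex_nonsqr_split | exact: ex_sqr_split].
have neq0 (x f : 'F_p) : f != 0 -> x ^+ p.-1./2 = f -> x != 0.
  exact: euler_neq0.
have one0 : (1 : 'F_p) != 0 by exact: oner_neq0.
have opp1 : (-1 : 'F_p) != 0 by rewrite oppr_eq0.
have countE (c c' : 'F_p) : c ^+ p.-1./2 = (-1) ^+ e ->
    c' ^+ p.-1./2 = (-1) ^+ e -> c != 1 -> c' != 1 ->
    (descent_count c b%:~R == descent_count c' b%:~R)
    = ((c - 1) ^+ p.-1./2 == (c' - 1) ^+ p.-1./2).
  move=> ce c'e c1 c'1; rewrite descent_count_eq ?residue_sum0_eq ?subr_eq0 //.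
  - exact: neq0 e0 ce.
  - exact: neq0 e0 c'e.
  - by rewrite ce.
have a_neq1 : a != 1 by rewrite -subr_eq0 (neq0 _ _ one0 a1).
have a'_neq1 : a' != 1 by rewrite -subr_eq0 (neq0 _ _ opp1 a'N).
pose v := descent_count a b%:~R; pose v' := descent_count a' b%:~R.
have neq_v : v != v'.
  by rewrite countE // a1 a'N eq_sym Fp_opp1_neq1.
(* Any count is determined by the class of [c - 1], and [a], [a'] realize both classes. *)
rewrite (_ : Np_values _ _ _ = [fset v; v']%fset) ?cardfs2 ?neq_v //.
apply/fsetP => w; rewrite !inE; apply/Np_valuesP/orP => //.
  move=> [c [c1 ce ->]]; rewrite !countE // a1 a'N.
  by have [|->|->] := @euler_pm1 p p_prime p_gt3 (c - 1);
    rewrite ?subr_eq0 ?eqxx //; [left|right].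
by case=> /eqP ->; [exists a | exists a'].
Qed.

Local Close Scope ring_scope.

Theorem theorem1p1 (p : nat) (p_prime : prime p) (p_gt3 : 3 < p) :
  (forall b : int,
     (p = 1 %[mod 4] -> #|` Sset p b| = 1 /\ #|` Tset p b| = 1) /\
     (p = 3 %[mod 4] -> #|` Sset p b| = 2 /\ #|` Tset p b| = 2)) /\
  (forall b b' : int, Sset p b = Sset p b').
Proof.
split=> [b|b b'].
  split=> pmod; split.
  - exact: (@Np_values_card1 p false).
  - exact: (@Np_values_card1 p true).
  - exact: (@Np_values_card2 p false).
  - exact: (@Np_values_card2 p true).
(* The same [a] witnesses membership for [b] and for [b']. *)
apply/fsetP => v.
by apply/(@Np_valuesP p p_prime p_gt3 false)/(@Np_valuesP p p_prime p_gt3 false)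
  => -[a [a1 ae ->]]; exists a; split => //; apply: descent_count_shift.
Qed.
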